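(* Let $\rho$ be a quantum state on a complex Hilbert space of finite dimension $d$. The maximal conditional max-entropy that can be extracted from $\rho$ using a projective measurement is $$H^*_{\max}=\log_2 d+\log_2\lambda_{\max}(\rho),$$ where $\lambda_{\max}(\rho)$ is the largest eigenvalue of $\rho$. That is, $\max_{\mathcal{M}}H_{\max}(X|E)=\log_2 d+\log_2\lambda_{\max}(\rho)$, the maximum being over all projective measurements $\mathcal{M}=\{M_x\}_x$, where $H_{\max}(X|E)$ is the max-entropy of the outcome $X$ of $\mathcal{M}$ on $\rho$ conditioned on the purifying system $E$.
   Context: A quantum state on a finite-dimensional Hilbert space $\mathcal{H}_A$ is a positive semidefinite operator of trace one. A projective measurement on $\mathcal{H}_A$ is a finite family $\mathcal{M}=\{M_x\}_x$ of positive semidefinite operators with $M_xM_{x'}=\delta_{xx'}M_x$ and $\sum_xM_x=\mathbb{1}$ (projectors of any rank). Let $|\Psi\rangle_{AE}\in\mathcal{H}_A\otimes\mathcal{H}_E$ be a purification of $\rho$, i.e. a unit vector with $\operatorname{tr}_E|\Psi\rangle\langle\Psi|=\rho$; the adversary Eve holds $E$. Measuring $\mathcal{M}$ on $A$ gives outcome $x$ with probability $p_x=\operatorname{tr}(M_x\rho)$ and leaves Eve in the state $\rho_E^x=\frac1{p_x}\operatorname{tr}_A[(M_x\otimes\mathbb{1}_E)|\Psi\rangle\langle\Psi|]$ (outcomes with $p_x=0$ are omitted). The conditional max-entropy of the outcome is $$H_{\max}(X|E)=\log_2 p_{\mathrm{secr}},\qquad p_{\mathrm{secr}}=\max_{\sigma}\Big(\sum_x\sqrt{p_x}\,F(\rho_E^x,\sigma)\Big)^2,$$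 where the maximum is over quantum states $\sigma$ on $\mathcal{H}_E$ and $F(\tau,\sigma)=\operatorname{tr}\sqrt{\sqrt{\sigma}\,\tau\,\sqrt{\sigma}}$. *)

(* Defs.v *)
From mathcomp Require Export all_boot all_order all_algebra.
From mathcomp Require Export spectral sesquilinear.
From mathcomp Require Export complex mxtens.
From mathcomp Require Export boolp classical_sets reals exp.

Set Implicit Arguments.
Unset Strict Implicit.
Unset Printing Implicit Defensive.

Export Order.TTheory GRing.Theory Num.Theory.

#[global] Open Scope complex_scope.
#[global] Open Scope sesquilinear_scope.
#[global] Open Scope classical_set_scope.
#[global] Open Scope ring_scope.

Definition is_max (R : realType) (S : set R) (m : R) : Prop :=
  S m /\ ubound S m.

Definition log2 (R : realType) (x : R) : R := ln x / ln 2.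

(* On [R[i]], [0 <= z] says that [z] is real and nonnegative, so [A] is
   automatically Hermitian. *)
Definition psd (R : realType) n (A : 'M[R[i]]_n) : Prop :=
  forall v : 'cV[R[i]]_n, 0 <= (v^t* *m A *m v) 0 0.

Definition state (R : realType) n (rho : 'M[R[i]]_n) : Prop :=
  psd rho /\ \tr rho = 1.

Definition projective_measurement (R : realType) n (X : finType)
    (M : X -> 'M[R[i]]_n) : Prop :=
  [/\ forall x, psd (M x),
      forall x y, M x *m M y = if x == y then M x else 0
    & \sum_x M x = 1%:M].

(* Functional calculus: for normal [A], [spectralmx A] is unitary and
   [A = invmx (spectralmx A) *m diag_mx (spectral_diag A) *m spectralmx A].
   For psd [A] this is its psd square root; it is junk if [A] is not normal. *)
Definition sqrtmx (R : realType) n (A : 'M[R[i]]_n) : 'M[R[i]]_n :=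
  invmx (spectralmx A) *m diag_mx (map_mx sqrtC (spectral_diag A))
    *m spectralmx A.

(* The trace is real and nonnegative when [tau] and [sigma] are psd. *)
Definition fidelity (R : realType) n (tau sigma : 'M[R[i]]_n) : R :=
  complex.Re (\tr (sqrtmx (sqrtmx sigma *m tau *m sqrtmx sigma))).

(* The space C^d (x) C^e is C^(d * e), with the index convention of [tensmx]. *)
Definition ptraceA (R : realType) d e (T : 'M[R[i]]_(d * e)) : 'M[R[i]]_e :=
  \matrix_(k, l) \sum_(a < d) T (mxtens_index (a, k)) (mxtens_index (a, l)).

Definition ptraceE (R : realType) d e (T : 'M[R[i]]_(d * e)) : 'M[R[i]]_d :=
  \matrix_(a, b) \sum_(k < e) T (mxtens_index (a, k)) (mxtens_index (b, k)).

Definition purification (R : realType) d e (rho : 'M[R[i]]_d)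
    (Psi : 'cV[R[i]]_(d * e)) : Prop :=
  Psi^t* *m Psi = 1%:M /\ ptraceE (Psi *m Psi^t*) = rho.

(* The trace is real when [P] and [rho] are psd. *)
Definition outcome_prob (R : realType) d (rho P : 'M[R[i]]_d) : R :=
  complex.Re (\tr (P *m rho)).

Definition cond_state (R : realType) d e (rho : 'M[R[i]]_d)
    (Psi : 'cV[R[i]]_(d * e)) (P : 'M[R[i]]_d) : 'M[R[i]]_e :=
  ((outcome_prob rho P)^-1)%:C *: ptraceA ((P *t 1%:M) *m (Psi *m Psi^t*)).

(* The maximum over states is the supremum: the states form a nonempty compact
   set and the fidelity is continuous. *)
Definition p_secr (R : realType) d e (rho : 'M[R[i]]_d)
    (Psi : 'cV[R[i]]_(d * e)) (X : finType) (M : X -> 'M[R[i]]_d) : R :=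
  sup [set (\sum_(x | outcome_prob rho (M x) != 0)
              Num.sqrt (outcome_prob rho (M x)) *
              fidelity (cond_state rho Psi (M x)) sigma) ^+ 2
      | sigma in [set s : 'M[R[i]]_e | state s]].

Definition Hmax (R : realType) d e (rho : 'M[R[i]]_d)
    (Psi : 'cV[R[i]]_(d * e)) (X : finType) (M : X -> 'M[R[i]]_d) : R :=
  log2 (p_secr rho Psi M).

(* A state has finitely many eigenvalues, all real, and at least one, so this
   supremum is the largest eigenvalue. *)
Definition lambda_max (R : realType) n (rho : 'M[R[i]]_n) : R :=
  sup [set l : R | eigenvalue rho l%:C].

(* Main.v *)
(* Let L : C^d -> C^e be the matrix of coordinates of Psi, so that L^* L is the
   transpose of rho and Eve's unnormalised state for outcome x is L Q_x L^*, with
   Q_x the transpose of M_x.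
   Upper bound: the positive operator A_x = sqrt(sigma) L Q_x L^* sqrt(sigma) has
   rank at most rank M_x, so 2 tr sqrt(A_x) <= c rank M_x + tr A_x / c for c > 0.
   The ranks sum to d and the traces to tr(L^* sigma L) <= lambda_max, and
   c = sqrt(lambda_max / d) gives sum_x tr sqrt(A_x) <= sqrt(d lambda_max).
   Attainment: let v be a unit vector with v rho = lambda_max v; measure in an
   orthonormal basis unbiased to v and let sigma be the pure state along L v^T.
   Each tr A_x is then lambda_max / d, and tr sqrt(A_x) >= sqrt(tr A_x). *)
Require Import Defs.
From mathcomp Require Import ring.

Set Implicit Arguments.
Unset Strict Implicit.
Unset Printing Implicit Defensive.

(** * Adjoints, unitary matrices with a prescribed row, unit eigenvectors *)

Section Adjoint.
Variable C : numClosedFieldType.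

Lemma trmxC_mul m n p (A : 'M[C]_(m, n)) (B : 'M[C]_(n, p)) :
  (A *m B)^t* = B^t* *m A^t*.
Proof. by rewrite trmx_mul map_mxM. Qed.

Lemma mx11_adjoint_mul_ge0 n (w : 'cV[C]_n) : 0 <= (w^t* *m w) 0 0.
Proof.
rewrite mxE sumr_ge0 // => i _.
by rewrite !mxE mulrC mul_conjC_ge0.
Qed.

Lemma unitarymx_adjointK n (U : 'M[C]_n) : U \is unitarymx -> U^t* *m U = 1%:M.
Proof. by move=> Uu; rewrite -(mulmxKtV 1%:M Uu erefl) mul1mx. Qed.

(** Gram-Schmidt on the matrix whose rows all equal [v] still returns a unitary matrix, and [v] is a
    multiple [c] of its first row. The scalar [c] is nonnegative and of modulus one, hence 1. *)
Lemma exists_unitarymx_row0 n (v : 'rV[C]_n.+1) :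
  v *m v^t* = 1%:M -> exists2 S : 'M[C]_n.+1, S \is unitarymx & row 0 S = v.
Proof.
move=> v1; pose A : 'M[C]_n.+1 := \matrix_(i < n.+1) v.
exists (schmidt A); first exact: schmidt_unitarymx.
have := row_schmidt_sub A 0.
rewrite rowK (big_pred1 0) => [|i]; last by rewrite /= leqn0.
rewrite genmxE => /sub_rVP[c vE].
have := form1_row_schmidt A 0; rewrite rowK.
rewrite {1}vE linearZl_LR /=.
have rU := @row_unitarymxP C n.+1 n.+1 (schmidt A).
have /rU/(_ 0 0) -> := schmidt_unitarymx A (leqnn _).
rewrite mulr1 => c0.
have : c * c^* = 1.
  have /rU/(_ 0 0) := schmidt_unitarymx A (leqnn _).
  rewrite dotmxE => r1.
  have /matrixP/(_ 0 0) := v1.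
  rewrite vE linearZ /= map_mxZ -scalemxAl -scalemxAr scalerA mxE r1.
  by rewrite !mxE mulr1.
rewrite conj_Creal ?ger0_real // => /eqP; rewrite -expr2 sqrp_eq1 // => /eqP c1.
by rewrite vE c1 scale1r.
Qed.

(* Applied with [h] the constant row, this gives a basis unbiased to [v]. *)
Lemma exists_unitarymx_mul n (v h : 'rV[C]_n.+1) :
  v *m v^t* = 1%:M -> h *m h^t* = 1%:M ->
  exists2 U : 'M[C]_n.+1, U \is unitarymx & v *m U^t* = h.
Proof.
move=> /exists_unitarymx_row0[S Su Sv] /exists_unitarymx_row0[T Tu Th].
exists (T^t* *m S); first by rewrite mul_unitarymx ?trmxC_unitary.
rewrite trmxC_mul trmxCK mulmxA -{}Sv -{}Th !rowE.
by rewrite (mulmxtVK _ Su).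
Qed.

Lemma exists_unit_eigenvector n (A : 'M[C]_n) (a : C) :
  eigenvalue A a -> exists2 v : 'rV[C]_n, v *m A = a *: v & v *m v^t* = 1%:M.
Proof.
case/eigenvalueP => u ua u0; set q := (u *m u^t*) 0 0.
have q0 : 0 < q by rewrite /q -dotmxE dotmx_is_dotmx.
exists ((sqrtC q)^-1 *: u).
  by rewrite -scalemxAl ua !scalerA mulrC.
rewrite linearZ map_mxZ -scalemxAl -scalemxAr scalerA /=.
have /CrealP -> : (sqrtC q)^-1 \is Num.real.
  by rewrite ger0_real // invr_ge0 sqrtC_ge0 ltW.
rewrite -invfM -expr2 sqrtCK [u *m _]mx11_scalar -/q scale_scalar_mx.
by rewrite mulVf // gt_eqF.
Qed.

End Adjoint.

(** Write [P] as [col_base P *m row_base P]. Cancelling the outer factors in [P *m P = P] leaves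
    [row_base P *m col_base P = 1%:M], of size [\rank P], and the trace is cyclic. *)
Lemma mxtrace_idempotent (F : fieldType) n (P : 'M[F]_n) :
  P *m P = P -> \tr P = (\rank P)%:R.
Proof.
move=> PP; rewrite -{1}(mulmx_base P) mxtrace_mulC.
suff -> : row_base P *m col_base P = 1%:M by rewrite mxtrace1.
apply: (row_full_inj (col_base_full P)); apply: (row_free_inj (row_base_free P)).
by rewrite /= mulmx1 mulmxA -mulmxA !mulmx_base.
Qed.

(** * Positive semidefinite matrices: spectral form, square root, trace inequalities *)

Section Psd.
Variable R : realType.
Local Notation C := R[i].

Lemma psd_adjoint_mul m n (B : 'M[C]_(m, n)) : psd (B^t* *m B).
Proof.
move=> v; rewrite mulmxA -mulmxA -trmxC_mul.
exact: mx11_adjoint_mul_ge0.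
Qed.

Lemma psd_conj m n (A : 'M[C]_n) (B : 'M[C]_(n, m)) :
  psd A -> psd (B^t* *m A *m B).
Proof.
by move=> Ap v; have := Ap (B *m v); rewrite trmxC_mul !mulmxA.
Qed.

Lemma psdD n (A B : 'M[C]_n) : psd A -> psd B -> psd (A + B).
Proof.
by move=> Ap Bp v; rewrite mulmxDr mulmxDl mxE addr_ge0.
Qed.

Lemma psdZ n (A : 'M[C]_n) c : 0 <= c -> psd A -> psd (c *: A).
Proof.
by move=> c0 Ap v; rewrite -scalemxAr -scalemxAl mxE mulr_ge0.
Qed.

(** The form of [A^T] at [v] is the form of [A] at the entrywise conjugate of [v]. *)
Lemma psd_trmx n (A : 'M[C]_n) : psd A -> psd A^T.
Proof.
move=> Ap v; have := Ap (map_mx Num.conj v).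
have -> : (map_mx Num.conj v)^t* = v^T.
  by apply/matrixP => i j; rewrite !mxE conjCK.
have -> : v^t* *m A^T *m v = (v^T *m A *m map_mx Num.conj v)^T.
  by rewrite !trmx_mul trmxK mulmxA map_trmx.
by rewrite [_^T _ _]mxE.
Qed.

Lemma psd_diag_ge0 n (A : 'M[C]_n) i : psd A -> 0 <= A i i.
Proof.
move=> /(_ (delta_mx i 0)).
by rewrite trmx_delta map_delta_mx -rowE -colE !mxE.
Qed.

Lemma mxtrace_psd_ge0 n (A : 'M[C]_n) : psd A -> 0 <= \tr A.
Proof. by move=> Ap; rewrite sumr_ge0 // => i _; rewrite psd_diag_ge0. Qed.

Lemma normalmx_spectralE n (A : 'M[C]_n) : A \is normalmx ->
  A = (spectralmx A)^t* *m diag_mx (spectral_diag A) *m spectralmx A.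
Proof.
move=> /orthomx_spectralP AE.
by rewrite -invmx_unitary ?spectral_unitarymx.
Qed.

Lemma spectral_diagE n (A : 'M[C]_n) i : A \is normalmx ->
  spectral_diag A 0 i = (spectralmx A *m A *m (spectralmx A)^t*) i i.
Proof.
move=> /normalmx_spectralE AE; have Su := spectral_unitarymx A.
rewrite {3}AE !mulmxA (unitarymxP Su) mul1mx (mulmxtVK _ Su).
by rewrite mxE eqxx mulr1n.
Qed.

(* [A - A^t*] is skew-adjoint, hence normal, and its quadratic form vanishes, so
   all its eigenvalues are zero. *)
Lemma psd_adjoint n (A : 'M[C]_n) : psd A -> A^t* = A.
Proof.
move=> Ap; set B := A - A^t*.
have BN : B^t* = - B by rewrite /B linearB /= map_mxB trmxCK opprB.
have Bn : B \is normalmx.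
  by apply/normalmxP; rewrite BN mulNmx mulmxN.
have B0 (v : 'cV[C]_n) : (v^t* *m B *m v) 0 0 = 0.
  rewrite /B mulmxBr mulmxBl.
  have -> : v^t* *m A^t* *m v = (v^t* *m A *m v)^t*.
    by rewrite !trmxC_mul trmxCK mulmxA.
  have /CrealP := ger0_real (Ap v).
  by rewrite !mxE => ->; rewrite subrr.
have d0 : spectral_diag B = 0.
  apply/rowP => i; rewrite spectral_diagE // [RHS]mxE.
  have := B0 ((spectralmx B)^t* *m delta_mx i 0).
  rewrite trmxC_mul trmxCK trmx_delta map_delta_mx -!mulmxA -rowE !mulmxA -colE.
  by move=> <-; rewrite [RHS]mxE [RHS]mxE.
apply/esym/eqP; rewrite -subr_eq0 -/B (normalmx_spectralE Bn) d0.
by rewrite raddf0 mulmx0 mul0mx.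
Qed.

Lemma psd_normalmx n (A : 'M[C]_n) : psd A -> A \is normalmx.
Proof. by move=> /psd_adjoint Ah; apply/normalmxP; rewrite Ah. Qed.

Lemma psd_spectral_diag_ge0 n (A : 'M[C]_n) i : psd A -> 0 <= spectral_diag A 0 i.
Proof.
move=> Ap; rewrite spectral_diagE ?psd_normalmx // psd_diag_ge0 //.
by have := psd_conj ((spectralmx A)^t*) Ap; rewrite trmxCK.
Qed.

Lemma sqrtmxE n (A : 'M[C]_n) : sqrtmx A =
  (spectralmx A)^t* *m diag_mx (map_mx sqrtC (spectral_diag A)) *m spectralmx A.
Proof. by rewrite /sqrtmx invmx_unitary ?spectral_unitarymx. Qed.

Lemma sqrtmx_sqr n (A : 'M[C]_n) : psd A -> sqrtmx A *m sqrtmx A = A.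
Proof.
move=> /psd_normalmx An; have Su := spectral_unitarymx A.
rewrite {3}(normalmx_spectralE An) sqrtmxE !mulmxA (mulmxtVK _ Su).
rewrite -(mulmxA _ (diag_mx _) (diag_mx _)) mulmx_diag; congr (_ *m diag_mx _ *m _).
by apply/rowP => i; rewrite !mxE -expr2 sqrtCK.
Qed.

Lemma sqrtmx_adjoint n (A : 'M[C]_n) : psd A -> (sqrtmx A)^t* = sqrtmx A.
Proof.
move=> Ap; rewrite sqrtmxE !trmxC_mul trmxCK mulmxA tr_diag_mx map_diag_mx.
congr (_ *m diag_mx _ *m _); apply/rowP => i; rewrite !mxE.
by apply/CrealP; rewrite ger0_real // sqrtC_ge0 psd_spectral_diag_ge0.
Qed.

Lemma mxtrace_spectral n (A : 'M[C]_n) : psd A ->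
  \tr A = \sum_i spectral_diag A 0 i.
Proof.
move=> /psd_normalmx An; rewrite {1}(normalmx_spectralE An).
rewrite -mulmxA mxtrace_mulC mulmxtVK ?spectral_unitarymx //.
exact: mxtrace_diag.
Qed.

Lemma mxtrace_sqrtmx n (A : 'M[C]_n) :
  \tr (sqrtmx A) = \sum_i sqrtC (spectral_diag A 0 i).
Proof.
rewrite sqrtmxE -mulmxA mxtrace_mulC mulmxtVK ?spectral_unitarymx //.
by rewrite mxtrace_diag; apply: eq_bigr => i _; rewrite mxE.
Qed.

Lemma mxtrace_sqrtmx_ge0 n (A : 'M[C]_n) : psd A -> 0 <= \tr (sqrtmx A).
Proof.
move=> Ap; rewrite mxtrace_sqrtmx sumr_ge0 // => i _.
by rewrite sqrtC_ge0 psd_spectral_diag_ge0.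
Qed.

Lemma psd_mxtrace_eq0 n (A : 'M[C]_n) : psd A -> \tr A = 0 -> A = 0.
Proof.
move=> Ap; rewrite mxtrace_spectral // => /eqP.
rewrite psumr_eq0 => [/allP d0|i _]; last exact: psd_spectral_diag_ge0.
rewrite (normalmx_spectralE (psd_normalmx Ap)).
have -> : spectral_diag A = 0.
  by apply/rowP => i; rewrite mxE; apply/eqP/d0; rewrite mem_index_enum.
by rewrite raddf0 mulmx0 mul0mx.
Qed.

(** For nonnegative numbers, the sum of the squares is at most the square of the sum; here the
    numbers are the roots of the eigenvalues. *)
Lemma mxtrace_le_sqr_sqrtmx n (A : 'M[C]_n) : psd A ->
  \tr A <= \tr (sqrtmx A) ^+ 2.
Proof.
move=> Ap; rewrite mxtrace_spectral // mxtrace_sqrtmx expr2 mulr_suml.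
apply: ler_sum => i _; rewrite -{1}[spectral_diag A 0 i]sqrtCK expr2.
have s0 j : 0 <= sqrtC (spectral_diag A 0 j).
  by rewrite sqrtC_ge0 psd_spectral_diag_ge0.
rewrite ler_wpM2l // (bigD1 i) //= lerDl sumr_ge0 //.
Qed.

(** By cyclicity this is the trace of [sqrtmx A *m B *m sqrtmx A], which is psd although [A *m B]
    need not be. *)
Lemma psd_mul_mxtrace_ge0 n (A B : 'M[C]_n) : psd A -> psd B -> 0 <= \tr (A *m B).
Proof.
move=> Ap Bp; rewrite -(sqrtmx_sqr Ap) -mulmxA mxtrace_mulC.
by rewrite mxtrace_psd_ge0 // -{1}(sqrtmx_adjoint Ap); exact: psd_conj.
Qed.

(* The rank counts the nonzero eigenvalues [m], and
   [2 sqrt m <= c + m / c] for each of them. *)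
Lemma mxtrace_sqrtmx_rank n (A : 'M[C]_n) (c : C) : psd A -> 0 < c ->
  2 * \tr (sqrtmx A) <= c * (\rank A)%:R + \tr A / c.
Proof.
move=> Ap c0; set m := spectral_diag A.
pose D : 'M[C]_n := diag_mx (map_mx (fun x => (x != 0)%:R) m).
have DD : D *m D = D.
  rewrite mulmx_diag; congr diag_mx; apply/rowP => i; rewrite !mxE.
  by case: eqP; rewrite ?mulr1 ?mulr0.
have rD : (\rank D <= \rank A)%N.
  (* As [0^-1 = 0], the inverted eigenvalues times the diagonal form of [A] give 1 at nonzero
     eigenvalues and 0 elsewhere, so [D] factors through [A]. *)
  have -> : D = diag_mx (map_mx GRing.inv m) *m
      (spectralmx A *m A *m (spectralmx A)^t*).
    have Su := spectral_unitarymx A.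
    rewrite {2}(normalmx_spectralE (psd_normalmx Ap)) !mulmxA.
    rewrite !(mulmxtVK _ Su) mulmx_diag.
    congr diag_mx; apply/rowP => i; rewrite !mxE.
    by case: eqP => [->|/eqP m0]; rewrite ?mulr0 ?mulVf.
  apply: leq_trans (mxrankM_maxr _ _) _; apply: leq_trans (mxrankM_maxl _ _) _.
  exact: mxrankM_maxr.
apply: (@le_trans _ _ (c * \tr D + \tr A / c)); last first.
  by rewrite (mxtrace_idempotent DD) lerD2r ler_pM2l // ler_nat.
rewrite mxtrace_sqrtmx mxtrace_diag mxtrace_spectral //.
rewrite !mulr_sumr mulr_suml -big_split /=.
apply: ler_sum => i _; rewrite mxE -/m.
have : 0 <= m 0 i by exact: psd_spectral_diag_ge0.
case: eqP => [-> _|/eqP _]; first by rewrite sqrtC0 !mulr0 mul0r addr0.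
rewrite -sqrtC_ge0 -{3}[m 0 i]sqrtCK; set s := sqrtC _ => s0.
rewrite mulr1 -subr_ge0.
have -> : c + s ^+ 2 / c - 2 * s = (c - s) ^+ 2 / c.
  by field; rewrite gt_eqF.
rewrite divr_ge0 ?(ltW c0) // real_exprn_even_ge0 //.
by rewrite rpredB ?ger0_real // ltW.
Qed.

End Psd.

Section MaxEntropy.
Variable R : realType.
Local Notation C := R[i].

Lemma Re_ge0_real (z : C) : 0 <= z -> (complex.Re z)%:C = z.
Proof. by move=> z0; rewrite RRe_real // ger0_real. Qed.

(** * The largest eigenvalue and its operator inequality *)

Section Largest.
Variables (n : nat) (rho : 'M[C]_n).
Hypothesis rho_psd : psd rho.

(** At the adjoint of a left eigenvector [v], the form of the difference is [m - l] times the
    squared norm of [v]. *)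
Lemma eigenvalue_le (l m : R) :
  psd (m%:C%:M - rho) -> eigenvalue rho l%:C -> l <= m.
Proof.
move=> mp /eigenvalueP[v vl v0]; have := mp (v^t*).
have vv : 0 < (v *m v^t*) 0 0 by rewrite -dotmxE dotmx_is_dotmx.
rewrite trmxCK mulmxBr mulmxBl vl mul_mx_scalar -!scalemxAl -scalerBl mxE.
by rewrite pmulr_lge0 // subr_ge0 lecR.
Qed.

Lemma eigenvalue_spectral_diag i : eigenvalue rho (spectral_diag rho 0 i).
Proof.
have Su := spectral_unitarymx rho.
apply/eigenvalueP; exists (row i (spectralmx rho)).
  rewrite -row_mul {2}(normalmx_spectralE (psd_normalmx rho_psd)) !mulmxA.
  rewrite (unitarymxP Su) mul1mx row_mul row_diag_mx.
  by rewrite -scalemxAl -rowE.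
apply/eqP => r0; have /row_unitarymxP/(_ i i) := Su.
by rewrite r0 eqxx linear0l => /esym/eqP; rewrite oner_eq0.
Qed.

Lemma psd_scalar_sub (m : C) :
  (forall i, spectral_diag rho 0 i <= m) -> psd (m%:M - rho).
Proof.
move=> mge v; have Su := spectral_unitarymx rho.
rewrite (normalmx_spectralE (psd_normalmx rho_psd)).
have -> : m%:M = (spectralmx rho)^t* *m m%:M *m spectralmx rho.
  by rewrite mul_mx_scalar -scalemxAl unitarymx_adjointK // scalemx1.
rewrite -mulmxBl -mulmxBr; apply: psd_conj => {}v.
rewrite -diag_const_mx -linearB /= -mulmxA mul_diag_mx mxE sumr_ge0 // => i _.
rewrite !mxE mulrCA mulr_ge0 // ?subr_ge0 //.
by rewrite mulrC mul_conjC_ge0.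
Qed.

(** These two facts are all that is used of [lambda_max] later: the first serves attainment, the
    second the upper bound. The supremum is the largest entry [mu k] of the spectral diagonal. *)
Lemma lambda_max_spec : (0 < n)%N ->
  eigenvalue rho (lambda_max rho)%:C /\ psd ((lambda_max rho)%:C%:M - rho).
Proof.
move=> n0; pose mu i := complex.Re (spectral_diag rho 0 i).
have muE i : (mu i)%:C = spectral_diag rho 0 i.
  by rewrite Re_ge0_real // psd_spectral_diag_ge0.
pose k := [arg max_(i > Ordinal n0) mu i]%O.
have kmax i : mu i <= mu k by rewrite /k; case: arg_maxP => //= j _; apply.
have kp : psd ((mu k)%:C%:M - rho).
  by apply: psd_scalar_sub => i; rewrite -muE lecR.
have kE : eigenvalue rho (mu k)%:C by rewrite muE eigenvalue_spectral_diag.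
suff -> : lambda_max rho = mu k by [].
have ub : ubound [set l : R | eigenvalue rho l%:C] (mu k).
  by move=> l; exact: eigenvalue_le.
apply/eqP; rewrite eq_le; apply/andP; split.
  by apply: ge_sup => //; exists (mu k).
by apply: ub_le_sup => //; exists (mu k).
Qed.

End Largest.

(** * Eve's states in terms of the coordinate matrix of the purification *)

Section Purification.
Variables (d e : nat) (rho : 'M[C]_d) (Psi : 'cV[C]_(d * e)).
Hypothesis Psi_rho : purification rho Psi.

(* The operator C^d -> C^e whose entries are the coordinates of [Psi]: Eve's
   unnormalised states are [purmx *m P^T *m purmx^t*]. *)
Definition purmx : 'M[C]_(e, d) := \matrix_(k, a) Psi (mxtens_index (a, k)) 0.
Local Notation L := purmx.

Lemma purmx_adjoint_mul : L^t* *m L = rho^T.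
Proof.
rewrite -Psi_rho.2; apply/matrixP => a b; rewrite !mxE; apply: eq_bigr => k _.
by rewrite !mxE big_ord1 !mxE mulrC.
Qed.

Lemma tens1mx_mul_entry (P : 'M[C]_d) a k :
  ((P *t 1%:M) *m Psi) (mxtens_index (a, k)) 0 = \sum_b P a b * L k b.
Proof.
rewrite mxE (reindex (@mxtens_index d e)) /=; last first.
  exists (@mxtens_unindex d e) => i _; [exact: mxtens_indexK | exact: mxtens_unindexK].
transitivity (\sum_b \sum_l (P *t 1%:M) (mxtens_index (a, k)) (mxtens_index (b, l))
    * Psi (mxtens_index (b, l)) 0).
  by rewrite pair_bigA; apply: eq_bigr => -[b l] _.
apply: eq_bigr => b _; rewrite (bigD1 k) //= big1 => [|l lk].
  by rewrite tensmxE !mxE eqxx mulr1 addr0.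
by rewrite tensmxE [_%:M _ _]mxE eq_sym (negPf lk) mulr0 mul0r.
Qed.

Lemma ptraceA_purmx (P : 'M[C]_d) :
  ptraceA ((P *t 1%:M) *m (Psi *m Psi^t*)) = L *m P^T *m L^t*.
Proof.
apply/matrixP => k l; rewrite !mxE; apply: eq_bigr => a _.
rewrite mulmxA [LHS]mxE big_ord1 tens1mx_mul_entry !mxE; congr (_ * _).
by apply: eq_bigr => b _; rewrite !mxE mulrC.
Qed.

Definition eve_state (P : 'M[C]_d) := L *m P^T *m L^t*.

Lemma cond_stateE P :
  cond_state rho Psi P = ((outcome_prob rho P)^-1)%:C *: eve_state P.
Proof. by rewrite /cond_state ptraceA_purmx. Qed.

Lemma psd_eve_state P : psd P -> psd (eve_state P).
Proof.
by move=> /psd_trmx /(psd_conj (L^t*)); rewrite trmxCK.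
Qed.

Lemma mxtrace_eve_state P : psd P -> \tr (eve_state P) = (outcome_prob rho P)%:C.
Proof.
move=> Pp; have := mxtrace_psd_ge0 (psd_eve_state Pp).
rewrite /outcome_prob /eve_state mxtrace_mulC mulmxA purmx_adjoint_mul.
by rewrite -trmx_mul mxtrace_tr => /Re_ge0_real ->.
Qed.

Lemma outcome_prob_ge0 P : psd P -> 0 <= outcome_prob rho P.
Proof.
move=> Pp; rewrite -lecR -mxtrace_eve_state //.
exact/mxtrace_psd_ge0/psd_eve_state.
Qed.

(** The sandwiched operator is psd, so the real part in [fidelity] loses nothing. Estimates on
    traces over [C] come back to [R] through this equation. *)
Lemma fidelityE (tau sigma : 'M[C]_e) : psd tau -> psd sigma ->
  (fidelity tau sigma)%:C = \tr (sqrtmx (sqrtmx sigma *m tau *m sqrtmx sigma))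
  /\ psd (sqrtmx sigma *m tau *m sqrtmx sigma).
Proof.
move=> tp sp.
have bp : psd (sqrtmx sigma *m tau *m sqrtmx sigma).
  by rewrite -{1}(sqrtmx_adjoint sp); exact: psd_conj.
by split=> //; rewrite /fidelity Re_ge0_real // mxtrace_sqrtmx_ge0.
Qed.

(** * Two-sided bounds on the contribution of a single outcome *)

Section Outcome.
Variables (P : 'M[C]_d) (sigma : 'M[C]_e).
Hypotheses (P_psd : psd P) (sigma_psd : psd sigma).
Hypothesis P_neq0 : outcome_prob rho P != 0.
Let p := outcome_prob rho P.
(** By cyclicity, the trace of the unnormalised operator [sqrtmx sigma *m eve_state P *m sqrtmx
    sigma]. *)
Let t := complex.Re (\tr (sigma *m eve_state P)).

Lemma outcome_prob_gt0 : 0 < p.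
Proof. by rewrite lt_neqAle eq_sym P_neq0 outcome_prob_ge0. Qed.

Lemma psd_cond_state : psd (cond_state rho Psi P).
Proof.
rewrite cond_stateE; apply: psdZ; last exact: psd_eve_state.
by rewrite lecR invr_ge0 ltW ?outcome_prob_gt0.
Qed.

Lemma mxtrace_sandwich_cond_state :
  \tr (sqrtmx sigma *m cond_state rho Psi P *m sqrtmx sigma) = (t / p)%:C.
Proof.
rewrite cond_stateE -scalemxAr -scalemxAl mxtraceZ mxtrace_mulC mulmxA sqrtmx_sqr //.
rewrite -/p mulrC rmorphM /= /t Re_ge0_real //.
by rewrite psd_mul_mxtrace_ge0 //; exact: psd_eve_state.
Qed.

Lemma fidelity_cond_state_ge0 : 0 <= fidelity (cond_state rho Psi P) sigma.
Proof.
have [FE Bp] := fidelityE psd_cond_state sigma_psd.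
by rewrite -lecR FE mxtrace_sqrtmx_ge0.
Qed.

Lemma outcome_term_ub (c : R) : 0 < c ->
  2 * (Num.sqrt p * fidelity (cond_state rho Psi P) sigma)
    <= c * (\rank P)%:R + t / c.
Proof.
move=> c0; have p0 := outcome_prob_gt0.
have [FE Bp] := fidelityE psd_cond_state sigma_psd.
set B := sqrtmx sigma *m _ *m _ in FE Bp.
have sp0 : 0 < Num.sqrt p by rewrite sqrtr_gt0.
have cs0 : 0 < c / Num.sqrt p by rewrite divr_gt0.
have rB : (\rank B <= \rank P)%N.
  apply: leq_trans (mxrankM_maxl _ _) _; apply: leq_trans (mxrankM_maxr _ _) _.
  rewrite cond_stateE; apply: leq_trans (mxrank_scale _ _) _.
  apply: leq_trans (mxrankM_maxl _ _) _; apply: leq_trans (mxrankM_maxr _ _) _.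
  by rewrite mxrank_tr.
(* [B] carries the normalisation [1 / p]; with the weight [c / Num.sqrt p], multiplying the bound by
   [Num.sqrt p] removes [p] from the right-hand side. *)
have := @mxtrace_sqrtmx_rank R e B (c / Num.sqrt p)%:C Bp.
rewrite ltcR => /(_ cs0).
rewrite -FE mxtrace_sandwich_cond_state -(rmorph_nat (real_complex R) 2).
rewrite -(rmorph_nat (real_complex R) (\rank B)) -fmorph_div -!rmorphM -rmorphD lecR.
set F := fidelity _ _ => bd.
have rR : (\rank B)%:R <= (\rank P)%:R :> R by rewrite ler_nat.
apply: (@le_trans _ _ (c * (\rank B)%:R + t / c)); last by rewrite lerD2r ler_pM2l.
rewrite mulrCA -ler_pdivlMl //; apply: le_trans bd _.
rewrite le_eqVlt; apply/orP; left; apply/eqP.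
have pE : p = Num.sqrt p ^+ 2 by rewrite sqr_sqrtr // ltW.
rewrite {2}pE; field.
by rewrite !gt_eqF.
Qed.

(** The sandwiched conditional state has trace [t / p], which is at most the squared fidelity;
    multiply by [p] and take roots. *)
Lemma outcome_term_lb :
  Num.sqrt t <= Num.sqrt p * fidelity (cond_state rho Psi P) sigma.
Proof.
have p0 := outcome_prob_gt0.
have [FE Bp] := fidelityE psd_cond_state sigma_psd.
have := mxtrace_le_sqr_sqrtmx Bp.
rewrite -FE mxtrace_sandwich_cond_state -rmorphXn lecR.
rewrite ler_pdivrMr // mulrC => bd.
rewrite -[fidelity _ _]ger0_norm ?fidelity_cond_state_ge0 //.
rewrite -sqrtr_sqr -sqrtrM ?(ltW p0) //.
exact: ler_wsqrtr.
Qed.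

End Outcome.

(** Passes the bound from [L^t* *m L] to [L *m L^t*] without comparing spectra: with [X] the target
    difference, [m X = X^t* X + L (m - L^t* L) L^t*], a sum of two psd terms. *)
Lemma psd_scalar_sub_purmx (m : R) : 0 < m ->
  psd (m%:C%:M - rho) -> psd (m%:C%:M - L *m L^t*).
Proof.
move=> m0 /psd_trmx; rewrite linearB /= tr_scalar_mx -purmx_adjoint_mul => mp.
have m0C : m%:C != 0 by rewrite gt_eqF // ltcR.
set X := _ - L *m L^t*.
have XX : X^t* = X.
  rewrite /X linearB /= map_mxB -/(_^t*) trmxC_mul trmxCK tr_scalar_mx map_scalar_mx.
  by congr (_%:M - _); apply/CrealP; rewrite ger0_real // lecR ltW.
have -> : X = (m%:C)^-1 *: (X^t* *m X + (L^t*)^t* *m (m%:C%:M - L^t* *m L) *m L^t*).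
  have -> : (L^t*)^t* *m (m%:C%:M - L^t* *m L) *m L^t* = X *m (L *m L^t*).
    by rewrite trmxCK mulmxBr !mulmxBl mul_mx_scalar mul_scalar_mx -scalemxAl !mulmxA.
  by rewrite XX -mulmxDr subrK mul_mx_scalar scalerA mulVf // scale1r.
apply: psdZ; first by rewrite invr_ge0 lecR ltW.
apply: psdD; first exact: psd_adjoint_mul.
exact: psd_conj.
Qed.

(** * The upper bound for an arbitrary projective measurement *)

Section Measurement.
Variables (X : finType) (M : X -> 'M[C]_d).
Hypothesis M_proj : projective_measurement M.

(** Each [M x] is idempotent, so its rank is its trace, and the traces add up to that of the
    identity. *)
Lemma sum_rank_measurement : (\sum_x \rank (M x))%N = d.
Proof.
have [_ MM M1] := M_proj.
have: (\sum_x \rank (M x))%:R = d%:R :> C.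
  rewrite natr_sum -(mxtrace1 C d) -M1 [RHS]raddf_sum /=; apply: eq_bigr => x _.
  by rewrite mxtrace_idempotent // MM eqxx.
by move/eqP; rewrite eqr_nat => /eqP.
Qed.

Lemma sum_eve_state : \sum_x eve_state (M x) = L *m L^t*.
Proof.
have [_ _ M1] := M_proj.
by rewrite /eve_state -mulmx_suml -mulmx_sumr -linear_sum M1 /= trmx1 mulmx1.
Qed.

(** The quantity squared in [p_secr]; the bounds on single outcomes add up at this level, before
    squaring. *)
Definition secrecy_sum (sigma : 'M[C]_e) : R :=
  \sum_(x | outcome_prob rho (M x) != 0)
    Num.sqrt (outcome_prob rho (M x)) * fidelity (cond_state rho Psi (M x)) sigma.

Lemma secrecy_sum_ge0 sigma : psd sigma -> 0 <= secrecy_sum sigma.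
Proof.
have [Mp _ _] := M_proj => sp.
rewrite sumr_ge0 // => x px; rewrite mulr_ge0 ?sqrtr_ge0 //.
exact: fidelity_cond_state_ge0.
Qed.

Lemma secrecy_sum_ub (sigma : 'M[C]_e) (m : R) : (0 < d)%N -> 0 < m ->
  psd (m%:C%:M - rho) -> state sigma -> secrecy_sum sigma ^+ 2 <= d%:R * m.
Proof.
have [Mp _ _] := M_proj => d0 m0 mp [sp s1].
have dR : 0 < d%:R :> R by rewrite ltr0n.
(* This choice balances the two halves of the bound: [c * d%:R = m / c]. *)
pose c := Num.sqrt (m / d%:R).
have c0 : 0 < c by rewrite sqrtr_gt0 divr_gt0.
have mE : m = d%:R * c ^+ 2.
  by rewrite sqr_sqrtr ?divr_ge0 ?ltW // mulrC divfK // gt_eqF.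
pose t x := complex.Re (\tr (sigma *m eve_state (M x))).
have tC x : (t x)%:C = \tr (sigma *m eve_state (M x)).
  by rewrite Re_ge0_real // psd_mul_mxtrace_ge0 //; exact: psd_eve_state.
have t0 x : 0 <= t x.
  by rewrite -lecR tC psd_mul_mxtrace_ge0 //; exact: psd_eve_state.
have tm : \sum_x t x <= m.
  rewrite -lecR rmorph_sum /=; under eq_bigr do rewrite tC.
  rewrite -raddf_sum -mulmx_sumr sum_eve_state.
  (* Pairing [m - L L^t*] with [sigma], of trace one, bounds the sum of the traces by [m]. *)
  have := psd_mul_mxtrace_ge0 sp (psd_scalar_sub_purmx m0 mp).
  by rewrite mulmxBr mul_mx_scalar linearB linearZ /= s1 mulr1 subr_ge0.
have : 2 * secrecy_sum sigma <= c * d%:R + m / c.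
  rewrite mulr_sumr.
  apply: (@le_trans _ _ (\sum_x (c * (\rank (M x))%:R + t x / c))).
    (* Outcomes of probability zero are absent on the left, but their ranks count in the total [d];
       on the right they contribute nonnegative terms. *)
    rewrite [leRHS](bigID (fun x => outcome_prob rho (M x) != 0)) /=.
    rewrite -[leLHS]addr0 lerD //.
      by apply: ler_sum => x px; exact: outcome_term_ub.
    apply: sumr_ge0 => x _; rewrite addr_ge0 ?mulr_ge0 ?invr_ge0 //; exact: ltW.
  rewrite big_split /= -mulr_sumr -mulr_suml -natr_sum sum_rank_measurement.
  by rewrite lerD2l ler_pM2r ?invr_gt0.
have -> : c * d%:R + m / c = 2 * (c * d%:R).
  by rewrite mE; field; rewrite gt_eqF.
rewrite ler_pM2l // => Sle.
have -> : d%:R * m = (c * d%:R) ^+ 2 by rewrite mE; ring.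
by rewrite lerXn2r // nnegrE ?secrecy_sum_ge0 // mulr_ge0 // ltW.
Qed.

End Measurement.

(** * Eve's pure-state guess and the matching lower bound *)

Section Optimal.
Variables (m : R) (v : 'rV[C]_d).
Hypotheses (rho_psd : psd rho) (m_gt0 : 0 < m) (v1 : v *m v^t* = 1%:M).
Hypothesis v_eigen : v *m rho = m%:C *: v.
Let w := L *m v^T.

Lemma rho_mul_eigen_adjoint : rho *m v^t* = m%:C *: v^t*.
Proof.
rewrite -{1}(psd_adjoint rho_psd) -trmxC_mul v_eigen linearZ /= map_mxZ.
by congr (_ *: _); apply/CrealP; rewrite ger0_real // lecR ltW.
Qed.

(** The product contains [L^t* *m L = rho^T] twice, once on each side of [Q^T]; each copy meets the
    eigenvector and yields a factor [m]. *)
Lemma purmx_eigen_quad (Q : 'M[C]_d) :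
  w^t* *m (L *m Q^T *m L^t*) *m w = (m%:C ^+ 2) *: (v *m Q *m v^t*)^T.
Proof.
rewrite /w trmxC_mul.
have -> : v^T^t* *m L^t* *m (L *m Q^T *m L^t*) *m (L *m v^T) =
    v^T^t* *m (L^t* *m L) *m Q^T *m (L^t* *m L) *m v^T by rewrite !mulmxA.
rewrite purmx_adjoint_mul.
have -> : v^T^t* = (v^t*)^T by rewrite map_trmx.
rewrite -!trmx_mul rho_mul_eigen_adjoint !mulmxA v_eigen.
by rewrite -!scalemxAr -!scalemxAl scalerA -expr2 linearZ.
Qed.

Lemma purmx_eigen_norm : w^t* *m w = m%:C%:M.
Proof.
rewrite /w trmxC_mul mulmxA -(mulmxA _ (L^t*)) purmx_adjoint_mul.
have -> : v^T^t* = (v^t*)^T by rewrite map_trmx.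
rewrite -!trmx_mul mulmxA v_eigen -scalemxAl v1.
by rewrite scalemx1 tr_scalar_mx.
Qed.

Definition eve_guess : 'M[C]_e := (m%:C)^-1 *: (w *m w^t*).

Let m_neq0 : m%:C != 0.
Proof. by rewrite gt_eqF // ltcR. Qed.

Lemma state_eve_guess : state eve_guess.
Proof.
split.
  apply: psdZ; first by rewrite invr_ge0 lecR ltW.
  by have := psd_adjoint_mul (w^t*); rewrite trmxCK.
rewrite mxtraceZ mxtrace_mulC purmx_eigen_norm mxtrace_scalar mulr1n.
by rewrite mulVf // m_neq0.
Qed.

(** The normalisation of [eve_guess] cancels one of the two factors [m] of [purmx_eigen_quad]. What
    multiplies [m] is the weight of [P] on the pure state of [v]. *)
Lemma mxtrace_eve_guess (P : 'M[C]_d) :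
  \tr (eve_guess *m eve_state P) = m%:C * (v *m P *m v^t*) 0 0.
Proof.
rewrite /eve_guess -scalemxAl mxtraceZ -mulmxA mxtrace_mulC.
rewrite /eve_state purmx_eigen_quad mxtraceZ mxtrace_tr mulrA.
rewrite expr2 mulKf ?m_neq0 //; congr (_ * _).
by rewrite /mxtrace big_ord1.
Qed.

Lemma secrecy_sum_lb (X : finType) (M : X -> 'M[C]_d) :
  (0 < d)%N -> #|X| = d -> projective_measurement M ->
  (forall x, (v *m M x *m v^t*) 0 0 = (d%:R)^-1) ->
  d%:R * m <= secrecy_sum M eve_guess ^+ 2.
Proof.
move=> d0 cardX Mpr Mv; have [Mp _ _] := Mpr; have [gp _] := state_eve_guess.
have dR : 0 < d%:R :> R by rewrite ltr0n.
have tE x : \tr (eve_guess *m eve_state (M x)) = (m / d%:R)%:C.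
  by rewrite mxtrace_eve_guess Mv rmorphM /= fmorphV /= rmorph_nat.
(* No outcome is omitted from [secrecy_sum]: at probability zero [eve_state (M x)] would vanish,
   against the trace [m / d%:R] found above. *)
have p0 x : outcome_prob rho (M x) != 0.
  apply/eqP => p0; have := tE x.
  have -> : eve_state (M x) = 0.
    apply: psd_mxtrace_eq0; first exact: psd_eve_state.
    by rewrite mxtrace_eve_state // p0.
  rewrite mulmx0 mxtrace0 => /esym/eqP; apply/negP.
  by rewrite gt_eqF // ltcR divr_gt0.
have : d%:R * Num.sqrt (m / d%:R) <= secrecy_sum M eve_guess.
  have -> : d%:R * Num.sqrt (m / d%:R) = \sum_(x : X) Num.sqrt (m / d%:R).
    by rewrite sumr_const cardX mulr_natl.
  rewrite /secrecy_sum; under [leRHS]eq_bigl do rewrite p0.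
  apply: ler_sum => x _; have := outcome_term_lb (Mp x) gp (p0 x).
  by rewrite tE.
move=> Sle; have -> : d%:R * m = (d%:R * Num.sqrt (m / d%:R)) ^+ 2.
  rewrite exprMn sqr_sqrtr; last by rewrite divr_ge0 // ltW.
  by field; rewrite gt_eqF.
by rewrite lerXn2r // nnegrE ?secrecy_sum_ge0 // mulr_ge0 ?sqrtr_ge0 // ltW.
Qed.

End Optimal.

End Purification.

(** * Measurement in the orthonormal basis of rows of a unitary matrix, and the unbiased case *)

Section RankOneMeasurement.
Variables (n : nat) (U : 'M[C]_n).
Hypothesis U_unitary : U \is unitarymx.

Definition row_proj (i : 'I_n) : 'M[C]_n := (row i U)^t* *m row i U.

Lemma row_proj_measurement : projective_measurement row_proj.
Proof.
split=> [i|i j|].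
- exact: psd_adjoint_mul.
- rewrite /row_proj -mulmxA (mulmxA (row i U)).
  have -> : row i U *m (row j U)^t* = (i == j)%:R%:M.
    apply/matrixP => a b; rewrite !ord1 -dotmxE.
    by have /row_unitarymxP -> := U_unitary; rewrite mxE eqxx mulr1n.
  by case: eqP => [->|_]; rewrite ?mul1mx // ?raddf0 ?mul0mx ?mulmx0.
- rewrite -(unitarymx_adjointK U_unitary); apply/matrixP => a b.
  rewrite summxE mxE; apply: eq_bigr => i _.
  by rewrite mxE big_ord1 !mxE.
Qed.

End RankOneMeasurement.
End MaxEntropy.

(** Rotate [v] to the constant unit row: its inner products with the rows of the unitary then all
    equal [a], and [a * a^*] is the inverse dimension. *)
Lemma exists_unbiased_measurement (R : realType) n (v : 'rV[R[i]]_n.+1) :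
  v *m v^t* = 1%:M ->
  exists M : 'I_n.+1 -> 'M[R[i]]_n.+1, projective_measurement M /\
    forall x, (v *m M x *m v^t*) 0 0 = (n.+1%:R)^-1.
Proof.
move=> v1; pose a : R[i] := (sqrtC n.+1%:R)^-1.
have aa : a * a^* = n.+1%:R^-1.
  have /CrealP -> : a \is Num.real by rewrite ger0_real // invr_ge0 sqrtC_ge0.
  by rewrite -invfM -expr2 sqrtCK.
have h1 : (const_mx a : 'rV_n.+1) *m (const_mx a : 'rV_n.+1)^t* = 1%:M.
  apply/matrixP => i j; rewrite !ord1 !mxE.
  under eq_bigr do rewrite !mxE aa.
  by rewrite sumr_const card_ord -[LHS]mulr_natl divff // pnatr_eq0.
have [U Uu vU] := exists_unitarymx_mul v1 h1.
exists (row_proj U); split=> [|x]; first exact: row_proj_measurement.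
have vx : v *m (row x U)^t* = a%:M.
  apply/matrixP => i j; rewrite !ord1.
  have /matrixP/(_ 0 x) := vU; rewrite !mxE mulr1n => <-.
  by apply: eq_bigr => k _; rewrite !mxE.
rewrite /row_proj mulmxA -mulmxA vx.
have -> : row x U *m v^t* = (a%:M)^t* by rewrite -vx trmxC_mul trmxCK.
by rewrite tr_scalar_mx map_scalar_mx -scalar_mxM aa mxE mulr1n.
Qed.

Theorem theorem3 (R : realType) (d e : nat) (rho : 'M[R[i]]_d)
    (Psi : 'cV[R[i]]_(d * e))
    (hrho : state rho) (hPsi : purification rho Psi) :
  is_max [set h : R | exists (X : finType) (M : X -> 'M[R[i]]_d),
                        projective_measurement M /\ h = Hmax rho Psi M]
         (log2 d%:R + log2 (lambda_max rho)).
Proof.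
(* Dimension zero is excluded, since the empty trace is not 1. *)
case: d => [|n] in rho Psi hrho hPsi *.
  by case: hrho => _ /esym/eqP; rewrite /mxtrace big_ord0 oner_eq0.
have [rp r1] := hrho.
have [eig lp] := lambda_max_spec rp (ltn0Sn n); set m := lambda_max rho in eig lp *.
have dR : 0 < n.+1%:R :> R by rewrite ltr0n.
(* The trace of the psd matrix [m - rho]. It gives [0 < m], and later that the claimed maximum is
   nonnegative. *)
have dm1 : 1 <= n.+1%:R * m.
  have := mxtrace_psd_ge0 lp.
  rewrite linearB /= r1 mxtrace_scalar subr_ge0.
  by rewrite -rmorphMn -(rmorph1 (real_complex R)) /= lecR mulr_natl.
have m0 : 0 < m by rewrite -(pmulr_rgt0 _ dR) (lt_le_trans ltr01).
have [v vm v1] := exists_unit_eigenvector eig.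
have gs : state (eve_guess Psi m v) by exact: (state_eve_guess hPsi m0 v1 vm).
have ub (X : finType) (M : X -> 'M[R[i]]_n.+1) : projective_measurement M ->
    ubound [set secrecy_sum rho Psi M sigma ^+ 2 | sigma in [set s | state s]]
      (n.+1%:R * m).
  by move=> Mp _ [sigma ss <-]; exact: secrecy_sum_ub.
have p_ub (X : finType) (M : X -> 'M[R[i]]_n.+1) :
    projective_measurement M -> p_secr rho Psi M <= n.+1%:R * m.
  move=> Mp; apply: ge_sup; last exact: ub.
  (* Here [eve_guess] only witnesses that the set under the supremum is nonempty. *)
  by exists (secrecy_sum rho Psi M (eve_guess Psi m v) ^+ 2), (eve_guess Psi m v).
have -> : log2 n.+1%:R + log2 m = log2 (n.+1%:R * m).
  by rewrite /log2 lnM ?posrE // mulrDl.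
split=> [|_ [X [M [Mp ->]]]].
  have [M [Mp Mv]] := exists_unbiased_measurement v1.
  exists 'I_n.+1, M; split=> //; rewrite /Hmax; congr log2.
  apply/eqP; rewrite eq_le p_ub // andbT.
  apply: le_trans (ub_le_sup _ _); last by exists (eve_guess Psi m v).
    by apply: secrecy_sum_lb => //; rewrite card_ord.
  by exists (n.+1%:R * m); exact: ub.
rewrite /Hmax /log2 ler_pM2r ?invr_gt0 ?ln_gt0 ?ltr1n //.
have [p0|p0] := lerP (p_secr rho Psi M) 0; first by rewrite ln0 // ln_ge0.
by rewrite ler_ln ?posrE ?p_ub // (lt_le_trans ltr01).
Qed.
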